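(* Consider the log income process $(X_t)_{t\ge0}$ determined by $(\lambda_1,\lambda_2,\mu,\nu,h)$ with $\lambda_1,\lambda_2>0$, where $h\equiv x_0$ for some $x_0\in\mathbb R$, $\nu=\delta_0$, and $\mu=\mathrm{Exp}(\theta)$ for some $\theta>0$. In this setting, for the income level $Y=e^X$, the tail of the unique stationary distribution is Pareto: when $X$ is distributed according to the unique stationary distribution of the log income process, then for all $y>y_0:=e^{x_0}$, $$\mathbb P(Y>y)=q\left(\frac{y}{y_0}\right)^{-\alpha}\quad\text{with}\quad \alpha:=\frac{\lambda_2\theta}{\lambda_1+\lambda_2},$$ where $q=\lambda_1/(\lambda_1+\lambda_2)$.
   Context: Log income process. Put $\lambda=\lambda_1+\lambda_2$, $q=\lambda_1/\lambda$, $p=\lambda_2/\lambda$. Let $(N_t)_{t\ge0}$ be a Poisson process with rate $\lambda$ and $X_t=Z_{N_t}$, where $Z_0=X_0$ and the embedded chain is $$Z_{n+1}=\begin{cases}Z_n+\eta_{n+1}&\text{with probability }q\ \text{(income shock)},\\ h(Z_n)+\zeta_{n+1}&\text{with probability }p\ \text{(reset)}.\end{cases}$$ Here $(\eta_n)$ and $(\zeta_n)$ are iid from $\mu$ and $\nu$ respectively; these sequences, the iid shock-type choices, the Poisson process and $X_0$ are independent. The transition probability function is $P_t(x,B)=\mathbb P\{X_t\in B\mid X_0=x\}$. A stationary distribution is a Borel probability measure $\phi^*$ on $\mathbb R$ with $\int P_t(x,B)\phi^*(dx)=\phi^*(B)$ for all $t\ge0$ and Borel $B$. $\mathrm{Exp}(\theta)$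 is the exponential distribution with rate $\theta$ (mean $1/\theta$), and $\delta_0$ is the point mass at $0$. *)

(* Defs.v *)
(* MathComp-Analysis development. *)
From HB Require Import structures.
From mathcomp Require Import all_boot all_order all_algebra.
From mathcomp Require Import finmap.
From mathcomp Require Import all_classical all_reals all_analysis.
Set Implicit Arguments.
Unset Strict Implicit.
Unset Printing Implicit Defensive.
Import Order.TTheory GRing.Theory Num.Theory.
Import numFieldNormedType.Exports.
Local Open Scope classical_set_scope.
Local Open Scope ring_scope.

Section Independence.
Context d (T : measurableType d) (R : realType) (P : probability T R).

Definition mutually_independent (I : choiceType) (F : I -> set (set T)) : Prop :=
  forall (J : {fset I}) (A : I -> set T),
    (forall i, i \in J -> F i (A i)) ->
    P (\big[setI/setT]_(i <- J) A i) = (\prod_(i <- J) P (A i))%E.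

Definition sigma_of d' (T' : measurableType d') (X : T -> T') : set (set T) :=
  preimage_set_system setT X measurable.

End Independence.

Section PoissonProcess.
Context d (T : measurableType d) (R : realType) (P : probability T R).

(* Time is the half-line [0, +oo[; the values of [N] at negative times are
   irrelevant. The subtraction in [pp_indep] is truncated, which is harmless
   because paths are nondecreasing. *)
Record poisson_process (rate : R) (N : R -> {RV P >-> nat}) : Prop := {
  pp_0 : forall w, N 0 w = 0%N ;
  pp_nondecreasing : forall w s t, 0 <= s -> s <= t -> (N s w <= N t w)%N ;
  pp_right_continuous :
    forall w t, 0 <= t -> \forall s \near t^'+, N s w = N t w ;
  pp_indep : forall t : nat -> R, 0 <= t 0%N ->
    (forall k, t k <= t k.+1) ->
    mutually_independent P
      (fun k : nat => sigma_of (fun w => (N (t k.+1) w - N (t k) w)%N)) ;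
  pp_increment : forall (s t : R) (k : nat), 0 <= s -> s < t ->
    P [set w | (N t w - N s w)%N = k] = (poisson_pmf (rate * (t - s)) k)%:E }.

Definition sigma_of_process (N : R -> T -> nat) : set (set T) :=
  <<s \bigcup_(t in [set t : R | 0 <= t]) sigma_of (N t) >>.

End PoissonProcess.

(* Labels of the independent sources of randomness. *)
Variant source :=
  Initial | Shock of nat | Reset of nat | Choice of nat | Clock.

HB.instance Definition _ := gen_eqMixin source.
HB.instance Definition _ := gen_choiceMixin source.

Section LogIncome.
Context d (T : measurableType d) (R : realType) (P : probability T R).

(* The variables with index [n] are those used in the step from [Z_n] to
   [Z_(n+1)]; [lip_choice n = true] is an income shock and [false] a reset.
   The laws [mu] and [nu] are only constrained on Borel sets, where the two
   law fields make them probability measures. *)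
Record log_income_process (lambda1 lambda2 : R) (mu nu : set R -> \bar R)
    (h : R -> R) := {
  lip_init : {RV P >-> R} ;
  lip_shock : nat -> {RV P >-> R} ;
  lip_reset : nat -> {RV P >-> R} ;
  lip_choice : nat -> {RV P >-> bool} ;
  lip_clock : R -> {RV P >-> nat} ;
  lip_h_measurable : measurable_fun setT h ;
  lip_shock_law : forall n (B : set R), measurable B ->
    distribution P (lip_shock n) B = mu B ;
  lip_reset_law : forall n (B : set R), measurable B ->
    distribution P (lip_reset n) B = nu B ;
  lip_choice_law : forall n,
    P [set w | lip_choice n w = true] = (lambda1 / (lambda1 + lambda2))%:E /\
    P [set w | lip_choice n w = false] = (lambda2 / (lambda1 + lambda2))%:E ;
  lip_clock_poisson : poisson_process (lambda1 + lambda2) lip_clock ;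
  lip_independent : mutually_independent P (fun i : source =>
    match i with
    | Initial => sigma_of lip_init
    | Shock n => sigma_of (lip_shock n)
    | Reset n => sigma_of (lip_reset n)
    | Choice n => sigma_of (lip_choice n)
    | Clock => sigma_of_process (fun t => lip_clock t)
    end) }.

Context (lambda1 lambda2 : R) (mu nu : set R -> \bar R) (h : R -> R).
Variable L : log_income_process lambda1 lambda2 mu nu h.

Fixpoint embedded_chain (Z0 : T -> R) (n : nat) (w : T) : R :=
  if n is m.+1 then
    let z := embedded_chain Z0 m w in
    if lip_choice L m w then z + lip_shock L m w
    else h z + lip_reset L m w
  else Z0 w.

Definition income_from (Z0 : T -> R) (t : R) (w : T) : R :=
  embedded_chain Z0 (lip_clock L t w) w.

Definition log_income : R -> T -> R := income_from (lip_init L).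

(* [P{X_t \in B | X_0 = x}]: as [X_0] is independent of the other sources, the
   conditional law given [X_0 = x] is the law of the process started at the
   constant [x]; this determines it for every [x], not only for almost every
   [x] under the law of [X_0]. *)
Definition transition_probability (t x : R) (B : set R) : \bar R :=
  P [set w | B (income_from (cst x) t w)].

Definition stationary_distribution (phi : probability (measurableTypeR R) R) :=
  forall t : R, 0 <= t -> forall B : set R, measurable B ->
    (\int[phi]_x transition_probability t x B)%E = phi B.

End LogIncome.

(* Main.v *)
Require Import Defs.
From HB Require Import structures.
From mathcomp Require Import all_boot all_order all_algebra.
From mathcomp Require Import finmap.
From mathcomp Require Import all_classical all_reals all_analysis.
From mathcomp Require Import measurable_realfun ring.
Set Implicit Arguments.
Unset Strict Implicit.
Unset Printing Implicit Defensive.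
Import Order.TTheory GRing.Theory Num.Theory.
Import numFieldNormedType.Exports.
Local Open Scope classical_set_scope.
Local Open Scope ring_scope.

(** Put [p = lambda2 / (lambda1 + lambda2)], so that [alpha = p * theta].
    Between two resets the log income climbs from [x0] by independent shocks of
    law [Exp theta], and long after the start the number of shocks since the
    last reset is [k] with probability [p * q ^ k]. It vanishes with probability
    [p]; otherwise it is geometric on the positive integers, and a geometric sum
    of exponentials of rate [theta] is exponential of rate [p * theta]. This
    gives the candidate
    [phi = p \d_x0 + q (x0 + Exp alpha)],
    whose tail, read through the exponential function, is the Pareto tail.

    Existence. A law left unchanged by one step of the embedded chain is
    stationary. To see it, start the chain from a point [x] drawn from [phi]
    independently of everything else, i.e. work under [phi \x P]. By
    induction [Z_n] has law [phi] and is independent of all the noise not used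
    so far ([chain_law]); as the clock is part of that noise, [Z_(N_t)] has law
    [phi] too ([invariant_stationary]). That [phi] is unchanged by one step
    reduces to the identity
    [Exp alpha = p Exp theta + q (Exp alpha * Exp theta)]
    ([exponential_one_more_shock]), in which the star is convolution. It
    expresses that a geometric sum either stops at its first term or goes on,
    and is verified on cumulative distribution functions.

    Uniqueness. As [h] is constant, two paths driven by the same noise from
    different starting points coincide from the first reset on
    ([chain_merge]). The transition probabilities from two points therefore
    differ by at most the probability that no reset occurs before time [t],
    which is [expR (- lambda2 t)] ([never_reset_law]) and tends to [0]. *)

(** * Events generated by independent sources *)

Section JointEvents.
Context d (T : measurableType d) (R : realType) (P : probability T R).
Context (I : choiceType) (F : I -> set (set T)).
Hypothesis indF : mutually_independent P F.
Hypothesis measF : forall i, F i `<=` measurable.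

Lemma independent_seq (s : seq I) (A : I -> set T) : uniq s ->
  (forall i, i \in s -> F i (A i)) ->
  P (\big[setI/setT]_(i <- s) A i) = (\prod_(i <- s) P (A i))%E.
Proof.
move=> us FA.
have s_fset : perm_eq s [fset i in s]%fset.
  by apply: uniq_perm => // i; rewrite inE.
rewrite !(perm_big _ s_fset) /=; apply: indF => i.
by rewrite inE; exact: FA.
Qed.

(** Besides the event itself, the predicate records a set [D] of sources that
    suffices to produce it: events of any source outside [D] are then
    independent of it, and can be intersected with it one at a time. *)
Definition joint_event (D : set I) (E : set T) : Prop :=
  exists s A, [/\ uniq s, forall i, i \in s -> D i /\ F i (A i) &
    E = \big[setI/setT]_(i <- s) A i].

Lemma joint_eventT D : joint_event D setT.
Proof. by exists [::], (fun=> setT); split=> //; rewrite big_nil. Qed.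

Lemma joint_eventS D D' E : D `<=` D' -> joint_event D E -> joint_event D' E.
Proof.
move=> DD' [s [A [us sA ->]]]; exists s, A; split=> // i /sA[/DD'].
by split.
Qed.

Lemma joint_event_measurable D E : joint_event D E -> measurable E.
Proof.
move=> [s [A [_ sA ->]]]; rewrite big_seq.
apply: big_ind => //; first exact: measurableI.
by move=> i /sA[_] /measF.
Qed.

Lemma joint_eventI D E i B : ~ D i -> F i B -> joint_event D E ->
  joint_event (i |` D) (B `&` E) /\ P (B `&` E) = (P B * P E)%E.
Proof.
move=> Di FB [s [A [us sA ->]]].
have si : i \notin s by apply/negP => /sA[].
pose A' j := if j == i then B else A j.
have AA' : \big[setI/setT]_(j <- s) A j = \big[setI/setT]_(j <- s) A' j.
  rewrite big_seq [RHS]big_seq; apply: eq_bigr => j js; rewrite /A' ifN//.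
  by apply: contraNneq si => <-.
have FA' j : j \in i :: s -> F j (A' j).
  rewrite inE /A'; case: eqVneq => [->//|_ /= /sA[]//].
have usi : uniq (i :: s) by rewrite /= si.
have BA' : B `&` \big[setI/setT]_(j <- s) A j =
    \big[setI/setT]_(j <- i :: s) A' j.
  by rewrite AA' big_cons /A' eqxx.
split.
  exists (i :: s), A'; split=> // j js; split; last exact: FA'.
  by move: js; rewrite inE => /predU1P[->|/sA[]]; [left|right].
rewrite BA' independent_seq// big_cons {1}/A' eqxx AA'.
rewrite independent_seq// => j js.
by apply: FA'; rewrite inE js orbT.
Qed.

Lemma joint_event1 D i B : D i -> F i B -> joint_event D B.
Proof.
move=> Di FB; rewrite -(setIT B).
have [//|+ _] := joint_eventI (D := set0) (i := i) _ FB (joint_eventT _).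
by apply: joint_eventS => j [->|].
Qed.

End JointEvents.

(** * Images of measures on product spaces *)

Section ImageOnProduct.
Local Open Scope ereal_scope.
Context d0 d1 d2 (T0 : measurableType d0) (T1 : measurableType d1)
  (T2 : measurableType d2) (R : realType).

(** Independence of two variables under a measure, given on rectangles, fixes
    their joint law as a product measure. *)
Lemma image_product_measure (m : {measure set T0 -> \bar R})
    (m1 : {sigma_finite_measure set T1 -> \bar R})
    (m2 : {sigma_finite_measure set T2 -> \bar R}) (f : T0 -> T1 * T2) :
  measurable_fun setT f ->
  (forall A B, measurable A -> measurable B ->
    m (f @^-1` (A `*` B)) = m1 A * m2 B) ->
  forall C, measurable C -> m (f @^-1` C) = (m1 \x m2) C.
Proof.
move=> mf mE C mC; rewrite -[LHS]/(pushforward m f C).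
by apply/esym; apply: product_measure_unique.
Qed.

Lemma product_measure_mscale (m1 : {sigma_finite_measure set T1 -> \bar R})
    (m2 : {finite_measure set T2 -> \bar R}) (c : {nonneg R}) C :
  measurable C -> (m1 \x mscale c m2) C = c%:num%:E * (m1 \x m2) C.
Proof.
move=> mC; rewrite -ge0_integralZl//.
exact: measurable_fun_xsection.
Qed.

End ImageOnProduct.

Section StepSet.
Context {R : realType}.

(** The pairs (position, noise) from which the move [z |-> g z + noise] lands in
    [B]; the law of the new position is read off from the measure of this set,
    with [g = id] for an income shock and [g = h] for a reset. *)
Definition step_into (g : R -> R) (B : set R) :
    set (measurableTypeR R * measurableTypeR R) :=
  [set uv | B (g uv.1 + uv.2)].

Lemma measurable_step_into g B : measurable_fun setT g -> measurable B ->
  measurable (step_into g B).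
Proof.
move=> mg mB; rewrite -[X in measurable X]setTI.
exact: (measurable_funD (measurableT_comp mg measurable_fst) measurable_snd).
Qed.

End StepSet.

(** * The embedded chain started from an invariant law *)

Section ChainLaw.
Context d (T : measurableType d) (R : realType) (P : probability T R).
Context (lambda1 lambda2 : R) (mu nu : probability (measurableTypeR R) R).
Context (h : R -> R) (L : log_income_process P lambda1 lambda2 mu nu h).

Let q := lambda1 / (lambda1 + lambda2).
Let p := lambda2 / (lambda1 + lambda2).

Definition source_sigma (i : source) : set (set T) :=
  match i with
  | Initial => sigma_of (lip_init L)
  | Shock n => sigma_of (lip_shock L n)
  | Reset n => sigma_of (lip_reset L n)
  | Defs.Choice n => sigma_of (lip_choice L n)
  | Clock => sigma_of_process (fun t => lip_clock L t)
  end.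

Lemma source_independent : mutually_independent P source_sigma.
Proof. exact: lip_independent. Qed.

Lemma sigma_of_measurable d' (T' : measurableType d') (X : {RV P >-> T'}) :
  sigma_of X `<=` measurable.
Proof.
move=> _ [A mA <-]; rewrite setTI -[_ @^-1` _]setTI.
exact: (measurable_funPT X).
Qed.

Lemma sigma_of_preimage d' (T' : measurableType d') (X : T -> T') (A : set T') :
  measurable A -> sigma_of X (X @^-1` A).
Proof. by move=> mA; exists A => //; rewrite setTI. Qed.

Lemma source_sigma_measurable i : source_sigma i `<=` measurable.
Proof.
case: i => [|n|n|n|] /=; try exact: sigma_of_measurable.
apply: smallest_sub; first exact: sigma_algebra_measurable.
by apply: bigcup_sub => t _; exact: sigma_of_measurable.
Qed.

Lemma clock_sigma t k : 0 <= t ->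
  source_sigma Clock (lip_clock L t @^-1` [set k]).
Proof.
move=> t0; apply: sub_sigma_algebra; exists t => //.
exact: sigma_of_preimage.
Qed.

(** The noise that [Z_n] has not consumed: step [k] uses the sources of index
    [k], and the clock only decides which [Z_n] is observed. *)
Definition future (n : nat) : set source := [set i |
  match i with
  | Initial => False
  | Shock k | Reset k | Defs.Choice k => (n <= k)%N
  | Clock => True
  end].

Lemma futureS n : future n.+1 `<=` future n.
Proof. by case=> //= k; exact: ltnW. Qed.

(** The starting point is made a coordinate, so that averaging it over a law
    [phi] amounts to working under the product measure [phi \x P]. *)
Definition chain (n : nat) (xw : measurableTypeR R * T) : measurableTypeR R :=
  embedded_chain L (cst xw.1) n xw.2.

Lemma measurable_chain n : measurable_fun setT (chain n).
Proof.
elim: n => [|n IH]; first exact: measurable_fst.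
apply: (measurable_fun_ifT
  (f := fun xw : measurableTypeR R * T => lip_choice L n xw.2)).
- exact: (measurableT_comp (measurable_funPT (lip_choice L n)) measurable_snd).
- apply: measurable_funD; first exact: IH.
  exact: (measurableT_comp (measurable_funPT (lip_shock L n)) measurable_snd).
- apply: measurable_funD.
    exact: (measurableT_comp (lip_h_measurable L) IH).
  exact: (measurableT_comp (measurable_funPT (lip_reset L n)) measurable_snd).
Qed.

Definition income (t : R) (xw : measurableTypeR R * T) : measurableTypeR R :=
  income_from L (cst xw.1) t xw.2.

Lemma income_by_clock t (B : set R) : income t @^-1` B = \bigcup_n
  (chain n @^-1` B `&` snd @^-1` (lip_clock L t @^-1` [set n])).
Proof.
apply/seteqP; split => [xw Bxw|xw [n _ [Bn /= Nn]]].
  by exists (lip_clock L t xw.2).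
by rewrite /income /income_from /= Nn.
Qed.

Lemma measurable_clock t n : measurable (lip_clock L t @^-1` [set n]).
Proof. by rewrite -[X in measurable X]setTI; exact: measurable_funPT. Qed.

Lemma measurable_chain_clock t n (B : set R) : measurable B ->
  measurable (chain n @^-1` B `&` snd @^-1` (lip_clock L t @^-1` [set n])).
Proof.
move=> mB; apply: measurableI; rewrite -[X in measurable X]setTI.
  exact: measurable_chain.
by apply: measurable_snd => //; exact: measurable_clock.
Qed.

Lemma measurable_income t : measurable_fun setT (income t).
Proof.
move=> _ B mB; rewrite setTI income_by_clock; apply: bigcup_measurable => n _.
exact: measurable_chain_clock.
Qed.

(** Tonelli: the law at time [t] from an initial law [phi]. *)
Lemma integral_transition (phi : probability (measurableTypeR R) R) t B :
  (\int[phi]_x transition_probability L t x B =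
   (phi \x P) (income t @^-1` B))%E.
Proof. by apply: eq_integral => x _ /=; rewrite xsectionE. Qed.

Lemma clock_total t (E : set T) : measurable E ->
  P E = (\sum_(n <oo) P (lip_clock L t @^-1` [set n] `&` E))%E.
Proof.
move=> mE; rewrite -measure_semi_bigcup.
- congr (P _); apply/seteqP; split=> [w Ew|w [n _ []//]].
  by exists (lip_clock L t w).
- by move=> n; apply: measurableI => //; exact: measurable_clock.
- by move=> m n _ _ [w [[/= <- _] [/= <- _]]].
- apply: bigcup_measurable => n _; apply: measurableI => //.
  exact: measurable_clock.
Qed.

Definition step_invariant (phi : probability (measurableTypeR R) R) :=
  forall B : set R, measurable B ->
  (q%:E * (phi \x mu) (step_into id B) +
   p%:E * (phi \x nu) (step_into h B) = phi B)%E.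

Section Invariant.
Variable phi : probability (measurableTypeR R) R.

(** Under [phi \x P], [Z_n] has law [phi] and is independent of the noise it has
    not used. The induction needs both halves together. *)
Definition chain_has_law n := forall B E, measurable B ->
  joint_event source_sigma (future n) E ->
  (phi \x P)%E (chain n @^-1` B `&` snd @^-1` E) = (phi B * P E)%E.

(** One move of the chain: [V] and [E] come from unused sources, hence [Z_n],
    [V] and [E] are independent, and on the event [E] the pair [(Z_n, V)] has
    law [phi \x rho] up to the factor [P E]. The set [D] supports [E] and leaves
    out the source [i] of [V]. *)
Lemma chain_noise_law n i (V : {RV P >-> R})
    (rho : probability (measurableTypeR R) R) D E (g : R -> R) (B : set R) :
  chain_has_law n ->
  sigma_of V `<=` source_sigma i ->
  (forall A : set R, measurable A -> distribution P V A = rho A) ->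
  ~ D i -> i |` D `<=` future n -> joint_event source_sigma D E ->
  measurable_fun setT g -> measurable B ->
  (phi \x P)%E ([set xw | B (g (chain n xw) + V xw.2)] `&` snd @^-1` E) =
  ((phi \x rho) (step_into g B) * P E)%E.
Proof.
move=> IH Vi Vrho Di iD DE mg mB.
have mE : measurable E := joint_event_measurable source_sigma_measurable DE.
have mTE : measurable (snd @^-1` E : set (measurableTypeR R * T)).
  by rewrite -[X in measurable X]setTI; exact: measurable_snd.
pose f xw := (chain n xw, V xw.2) : measurableTypeR R * measurableTypeR R.
have mf : measurable_fun setT f.
  apply: measurable_fun_pair; first exact: measurable_chain.
  exact: (measurableT_comp (measurable_funPT V) measurable_snd).
have PE0 : 0 <= fine (P E) by rewrite fine_ge0.
have mC := measurable_step_into mg mB.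
transitivity (mrestr (phi \x P)%E mTE
    (f @^-1` step_into g B)); first by [].
rewrite (image_product_measure (m1 := phi) (m2 := mscale (NngNum PE0) rho))//.
  by rewrite product_measure_mscale//= fineK ?fin_num_measure// muleC.
move=> A1 A2 mA1 mA2; rewrite /mrestr.
have fA : f @^-1` (A1 `*` A2) `&` snd @^-1` E =
    chain n @^-1` A1 `&` snd @^-1` (V @^-1` A2 `&` E).
  by apply/seteqP; split => [xw [[]]|xw [? []]].
rewrite [LHS](congr1 (phi \x P)%E fA).
have [VE PVE] := joint_eventI source_independent Di
  (Vi _ (sigma_of_preimage V mA2)) DE.
rewrite IH//; last exact: joint_eventS VE.
congr (_ * _)%E; rewrite PVE /= /mscale /= fineK ?fin_num_measure// muleC.
by congr (_ * _)%E; rewrite -Vrho.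
Qed.

Lemma choice_joint_event n (b : bool) E :
  let C := lip_choice L n @^-1` [set b] in
  joint_event source_sigma (future n.+1) E ->
  joint_event source_sigma (Defs.Choice n |` future n.+1) (C `&` E) /\
  P (C `&` E) = ((if b then q else p)%:E * P E)%E.
Proof.
move=> C FE; have FC : source_sigma (Defs.Choice n) C.
  exact: sigma_of_preimage.
have nC : ~ future n.+1 (Defs.Choice n) by rewrite /= ltnn.
have [CE ->] := joint_eventI source_independent nC FC FE; split=> //.
by have [Ct Cf] := lip_choice_law L n; congr (_ * _)%E; case: b @C FC CE.
Qed.

Hypothesis phi_invariant : step_invariant phi.

(** According to the [n]-th choice the next position is [Z_n + eta] or
    [h Z_n + zeta]. On each of the two events [chain_noise_law] applies, and
    the two contributions add up to [phi] by invariance. *)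
Lemma chain_law n : chain_has_law n.
Proof.
elim: n => [|n IH] B E mB FE.
  have mE := joint_event_measurable source_sigma_measurable FE.
  by rewrite -product_measure1E.
have mE := joint_event_measurable source_sigma_measurable FE.
pose C b := lip_choice L n @^-1` [set b] `&` E.
have choice_future : Defs.Choice n |` future n.+1 `<=` future n.
  by move=> _ [->|/futureS//]; rewrite /= leqnn.
pose S1 := [set xw : measurableTypeR R * T |
  B (id (chain n xw) + lip_shock L n xw.2)] `&` snd @^-1` C true.
pose S2 := [set xw : measurableTypeR R * T |
  B (h (chain n xw) + lip_reset L n xw.2)] `&` snd @^-1` C false.
have S12 : chain n.+1 @^-1` B `&` snd @^-1` E = S1 `|` S2.
  apply/seteqP; rewrite /S1 /S2 /C /chain /=; split => -[x w] /=.
    by case: (lip_choice L n w) => -[Bc Ew]; [left|right].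
  by case: (lip_choice L n w) => -[[? []]|[? []]].
have [C1 PC1] := choice_joint_event true FE.
have [C2 PC2] := choice_joint_event false FE.
have mC b : measurable (C b).
  by case: b; [move: C1|move: C2];
    exact/joint_event_measurable/source_sigma_measurable.
have mS (g : R -> R) (V : {RV P >-> R}) b :
    measurable_fun setT g ->
    measurable ([set xw : measurableTypeR R * T |
      B (g (chain n xw) + V xw.2)] `&` snd @^-1` C b).
  move=> mg; apply: measurableI; rewrite -[X in measurable X]setTI.
    apply: (measurable_funD (measurableT_comp mg (measurable_chain n))
      (measurableT_comp (measurable_funPT V) measurable_snd)) => //.
  exact: measurable_snd.
have S1E : (phi \x P)%E S1 = ((phi \x mu) (step_into id B) * P (C true))%E.
  apply: (chain_noise_law (i := Shock n) IH _ _ _ _ C1) => //.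
  - exact: (lip_shock_law L).
  - by case=> //; rewrite /= ltnn.
  - by move=> _ [->|/choice_future//]; rewrite /= leqnn.
have S2E : (phi \x P)%E S2 = ((phi \x nu) (step_into h B) * P (C false))%E.
  apply: (chain_noise_law (i := Reset n) IH _ _ _ _ C2) => //.
  - exact: (lip_reset_law L).
  - by case=> //; rewrite /= ltnn.
  - by move=> _ [->|/choice_future//]; rewrite /= leqnn.
  - exact: (lip_h_measurable L).
rewrite S12 measureU; last 3 first.
- exact: mS.
- by apply: mS; exact: (lip_h_measurable L).
- apply/seteqP; split => // -[x w] [[_ [/= choice_true _]] [_ [/= + _]]].
  by rewrite choice_true.
rewrite [X in (X + _)%E]S1E [X in (_ + X)%E]S2E PC1 PC2.
have [[Pt Pf] P0] := (lip_choice_law L n, measure_ge0 P).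
have [q0 p0] : (0 <= q%:E)%E /\ (0 <= p%:E)%E by rewrite -Pt -Pf.
rewrite -phi_invariant// [RHS]ge0_muleDl ?mule_ge0//.
by congr (_ + _)%E; rewrite muleCA muleA.
Qed.

(** The clock is never used by the embedded chain, hence [Z_n] has law [phi] on
    each event [N_t = n]. *)
Lemma invariant_stationary : stationary_distribution L phi.
Proof.
move=> t t0 B mB; rewrite integral_transition income_by_clock.
rewrite measure_semi_bigcup; last 3 first.
- by move=> n; exact: measurable_chain_clock.
- by move=> m n _ _ [xw [[_ /= <-] [_ /= <-]]].
- by apply: bigcup_measurable => n _; exact: measurable_chain_clock.
transitivity (\sum_(n <oo) phi B * P (lip_clock L t @^-1` [set n] `&` setT))%E.
  apply: eq_eseriesr => n _; rewrite setIT; apply: chain_law => //.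
  exact: (joint_event1 source_independent _ (clock_sigma n t0)).
rewrite -(fineK (fin_num_measure phi B mB)) nneseriesZl// -clock_total//.
by rewrite probability_setT mule1.
Qed.

End Invariant.

(** * Merging of paths and uniqueness *)

Definition no_reset (n : nat) : set T :=
  [set w | forall k, (k < n)%N -> lip_choice L k w = true].

Lemma no_resetS n :
  no_reset n.+1 = no_reset n `&` lip_choice L n @^-1` [set true].
Proof.
apply/seteqP; split=> w /= => [nr|[nr cn] k].
  by split=> [k kn|]; apply: nr => //; exact: ltnW.
by rewrite ltnS leq_eqVlt => /predU1P[->//|/nr].
Qed.

Lemma no_reset0 : no_reset 0 = setT.
Proof. by apply/seteqP. Qed.

Lemma measurable_no_reset n : measurable (no_reset n).
Proof.
elim: n => [|n IH]; first by rewrite no_reset0.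
rewrite no_resetS; apply: measurableI => //.
by rewrite -[X in measurable X]setTI; exact: measurable_funPT.
Qed.

Lemma no_reset_law n E : joint_event source_sigma (future n) E ->
  P (no_reset n `&` E) = ((q ^+ n)%:E * P E)%E.
Proof.
elim: n E => [|n IH] E FE; first by rewrite no_reset0 setTI expr0 mul1e.
have [CE PCE] := choice_joint_event true FE.
rewrite no_resetS -setIA IH ?PCE ?exprSr ?EFinM ?muleA//.
by apply: joint_eventS CE => _ [->|/futureS//]; rewrite /= leqnn.
Qed.

Section Merging.
Hypothesis h_cst : forall x y, h x = h y.

(** A reset forgets the past: it moves both paths to the common value of [h]
    plus the same noise, and from then on they receive the same moves. *)
Lemma chain_merge n x y w : ~ no_reset n w -> chain n (x, w) = chain n (y, w).
Proof.
elim: n => [|n IH]; first by rewrite no_reset0 => -[].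
rewrite no_resetS /chain /=; case: ifPn => [cn nr|_ _].
  by congr (_ + _); apply: IH => nrn; apply: nr; split=> //.
by congr (_ + _); exact: h_cst.
Qed.

Definition never_reset (t : R) : set T :=
  [set w | no_reset (lip_clock L t w) w].

Lemma never_reset_by_clock t n :
  lip_clock L t @^-1` [set n] `&` never_reset t =
  no_reset n `&` lip_clock L t @^-1` [set n].
Proof. by apply/seteqP; split => w [/= ? ?]; subst n. Qed.

Lemma measurable_never_reset t : measurable (never_reset t).
Proof.
have -> : never_reset t =
    \bigcup_n (no_reset n `&` lip_clock L t @^-1` [set n]).
  apply/seteqP; split => [w nr|w [n _]]; first by exists (lip_clock L t w).
  by rewrite -never_reset_by_clock => -[].
apply: bigcup_measurable => n _; apply: measurableI.
  exact: measurable_no_reset.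
exact: measurable_clock.
Qed.

Lemma transition_merge t x y (B : set R) : measurable B ->
  (transition_probability L t x B <=
   transition_probability L t y B + P (never_reset t))%E.
Proof.
move=> mB; have mI z : measurable [set w | B (income_from L (cst z) t w)].
  rewrite -[X in measurable X]setTI.
  exact: (measurable_fun_pair2 z (measurable_income t)).
have mNR := measurable_never_reset t.
apply: le_trans (measureU2 P (mI y) mNR).
apply: le_measure; rewrite ?inE//; first exact: measurableU.
move=> w /= Bx; have [nr|nr] := pselect (never_reset t w); [by right|left].
by have := chain_merge x y nr; rewrite /chain /income_from /= => <-.
Qed.

Hypotheses (lambda1_gt0 : 0 < lambda1) (lambda2_gt0 : 0 < lambda2).

Lemma eseries_exp_coeff (x : R) :
  (\sum_(n <oo) (exp_coeff x n)%:E = (expR x)%:E)%E.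
Proof.
rewrite -EFin_lim; last exact: is_cvg_series_exp_coeff.
by apply/congr_lim/funext => n /=; rewrite sumEFin.
Qed.

(** Resets form a Poisson process of rate [lambda2]: thinning each of the [N_t]
    steps gives the series of [q ^ n (lambda t) ^ n / n!], where
    [lambda q = lambda1]. *)
Lemma never_reset_law t : 0 < t ->
  P (never_reset t) = (expR (- (lambda2 * t)))%:E.
Proof.
move=> t0; have t0' := ltW t0.
have lambda_gt0 : 0 < lambda1 + lambda2 by exact: addr_gt0.
rewrite (clock_total t (measurable_never_reset t)).
transitivity (\sum_(n <oo) (expR (- ((lambda1 + lambda2) * t)))%:E *
    (exp_coeff (lambda1 * t) n)%:E)%E.
  apply: eq_eseriesr => n _.
  rewrite never_reset_by_clock no_reset_law; last first.
    exact: (joint_event1 source_independent _ (clock_sigma n t0')).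
  have := pp_increment (lip_clock_poisson L) n (lexx 0) t0.
  under eq_set do rewrite (pp_0 (lip_clock_poisson L)) subn0.
  move=> ->; rewrite subr0 /poisson_pmf mulr_gt0// /exp_coeff /= -!EFinM.
  congr _%:E; rewrite [RHS]mulrC !mulrA; congr (_ * _ * _).
  by rewrite -exprMn /q mulrA divfK// gt_eqF.
rewrite nneseriesZl; last first.
  by move=> n _; rewrite lee_fin exp_coeff_ge0// mulr_ge0// ltW.
rewrite eseries_exp_coeff -EFinM -expRD; congr (expR _)%:E.
by rewrite mulrDl opprD addrAC addNr add0r.
Qed.

(** Averaging the merging bound over each of the two laws in turn shows that
    they differ by at most [expR (- lambda2 t)] on [B], for every [t]. *)
Lemma stationary_unique (psi phi : probability (measurableTypeR R) R) :
  stationary_distribution L psi -> stationary_distribution L phi ->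
  forall B : set R, measurable B -> psi B = phi B.
Proof.
move=> + + B mB.
suff le_law (chi xi : probability (measurableTypeR R) R) :
    stationary_distribution L chi -> stationary_distribution L xi ->
    (chi B <= xi B)%E.
  by move=> ? ?; apply/eqP; rewrite eq_le !le_law.
move=> Schi Sxi.
have bound t : 0 < t -> (chi B <= xi B + (expR (- (lambda2 * t)))%:E)%E.
  move=> t0; rewrite -never_reset_law//.
  have mtr : measurable_fun setT (fun x : measurableTypeR R =>
      transition_probability L t x B).
    rewrite (_ : (fun x => _) = P \o xsection (income t @^-1` B)).
      apply: measurable_fun_xsection; rewrite -[X in measurable X]setTI.
      exact: measurable_income.
    by apply/funext => x /=; rewrite xsectionE.
  have tr_ge0 x : (0 <= transition_probability L t x B)%E by exact: measure_ge0.
  have chi_le y : (chi B <=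
      transition_probability L t y B + P (never_reset t))%E.
    rewrite -(Schi t (ltW t0) B mB).
    rewrite -[leRHS]mule1 -(probability_setT chi) -integral_cst//.
    apply: ge0_le_integral => //.
    by move=> x _; exact: transition_merge.
  rewrite -[leLHS]mule1 -(probability_setT xi) -integral_cst//.
  apply: (@le_trans _ _
      (\int[xi]_x (transition_probability L t x B + P (never_reset t)))%E).
    by apply: ge0_le_integral => //; exact: emeasurable_funD.
  rewrite ge0_integralD//.
  rewrite (Sxi t (ltW t0) B mB) integral_cst//.
  by rewrite -[X in (_ <= _ + X)%E]mule1 -(probability_setT xi).
apply/lee_addgt0Pr => e e0.
(* at this time, [expR (lambda2 t) >= 1 + e^-1] makes the error at most [e] *)
have t0 : 0 < (lambda2 * e)^-1 by rewrite invr_gt0 mulr_gt0.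
apply: (le_trans (bound _ t0)); rewrite leeD2l// lee_fin.
rewrite expRN invf_ple ?posrE ?expR_gt0//.
have -> : lambda2 * (lambda2 * e)^-1 = e^-1.
  by rewrite invfM mulrA divff ?mul1r// gt_eqF.
by apply: le_trans (expR_ge1Dx _); rewrite lerDr.
Qed.

End Merging.

End ChainLaw.

(** * Probability laws on the real line *)

Section ProbabilitiesOnTheLine.
Context {R : realType}.
Local Notation law := (probability (measurableTypeR R) R).
Implicit Types P : law.

Lemma eq_law_cdf P1 P2 :
  (forall x : R, P1 `]-oo, x]%classic = P2 `]-oo, x]%classic) ->
  forall B : set R, measurable B -> P1 B = P2 B.
Proof.
move=> P12 B mB; pose G := [set B : set R | exists x, B = `]-oo, x]%classic].
apply: (@measure_unique _ _ (measurableTypeR R) G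
  (fun n => `]-oo, n%:R]%classic) _ _ _ _ P1 P2) => //.
- transitivity (<<s @RGenOInfty.G R >>); first exact: RGenOInfty.measurableE.
  apply/seteqP.
  split; apply: smallest_sub; try exact: smallest_sigma_algebra.
    move=> _ [x ->]; rewrite -setCitvl; apply: sigma_algebraC.
    by apply: sub_sigma_algebra; exists x.
  move=> _ [x ->]; rewrite -setCitvr; apply: sigma_algebraC.
  by apply: sub_sigma_algebra; exists x.
- move=> _ _ [x ->] [y ->]; exists (Num.min x y).
  apply/seteqP; split=> z; rewrite /= !in_itv/= le_min; first by case=> -> ->.
  by move/andP.
- by move=> n; exists n%:R.
- apply/seteqP; split=> // x _; exists (Num.truncn `|x|).+1 => //=.
  rewrite in_itv/= (le_trans (ler_norm x))// ltW//.
  exact: truncnS_gt.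
- by move=> _ [x ->]; exact: P12.
- by move=> n; rewrite -ge0_fin_numE// fin_num_measure.
Qed.

Lemma mixture_law (a b : R) P1 P2 : 0 <= a -> 0 <= b -> a + b = 1 ->
  exists Q : law, forall B : set R, measurable B ->
    Q B = (a%:E * P1 B + b%:E * P2 B)%E.
Proof.
move=> a0 b0 ab1.
pose m : {measure set (measurableTypeR R) -> \bar R} :=
  measure_add (mscale (NngNum a0) P1) (mscale (NngNum b0) P2).
have m1 : m setT = 1%E.
  transitivity (a%:E * 1 + b%:E * 1)%E; last by rewrite !mule1 -EFinD ab1.
  rewrite [LHS]measure_addE; congr (_ * _ + _ * _)%E; exact: probability_setT.
(* the total mass is already one: normalizing only records this fact *)
exists (mnormalize m P1) => B mB; rewrite /= /mnormalize m1 onee_eq0/=.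
by rewrite invr1 mule1 [LHS]measure_addE.
Qed.

Lemma mixture_product (a b : R) P1 P2 (Q mu : law) C : 0 <= a -> 0 <= b ->
  (forall B : set R, measurable B -> Q B = (a%:E * P1 B + b%:E * P2 B)%E) ->
  measurable C ->
  ((Q \x mu) C = a%:E * (P1 \x mu) C + b%:E * (P2 \x mu) C)%E.
Proof.
move=> a0 b0 QE mC; pose m1 := mscale (NngNum a0) P1.
pose m2 := mscale (NngNum b0) P2.
rewrite [LHS](eq_measure_integral (measure_add m1 m2)); last first.
  by move=> B mB _; rewrite [RHS]measure_addE; exact: QE.
have mf : measurable_fun setT (mu \o xsection C).
  exact: measurable_fun_xsection.
by rewrite ge0_integral_measure_add// !ge0_integral_mscale.
Qed.

Lemma image_law d (T : measurableType d) (P : probability T R)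
    (f : T -> measurableTypeR R) : measurable_fun setT f ->
  exists Q : law, forall B : set R, Q B = P (f @^-1` B).
Proof.
by move=> mf; exists (distribution P (mfun_Sub (mem_set mf))).
Qed.

End ProbabilitiesOnTheLine.

(** * Exponential laws *)

Section Exponential.
Context {R : realType}.
Local Notation law := (probability (measurableTypeR R) R).
Local Notation leb := (@lebesgue_measure R).

(** [exponential_prob rate] has mass [1] only when the rate is positive, whence
    the proof carried along. *)
Definition exponential_law (rate : R) (rate_gt0 : 0 < rate) : law.
Proof. by refine (exponential_prob rate : law). Defined.

Section OneRate.
Context {rate : R} (rate_gt0 : 0 < rate).

Lemma exponential_cdf x : exponential_prob rate `]-oo, x]%classic =
  (1 - expR (- rate * Num.max 0 x))%:E.
Proof.
have [x0|x0] := ltP x 0.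
  rewrite mulr0 expR0 subrr /exponential_prob integral0_eq// => z.
  rewrite /= in_itv/= => zx.
  by rewrite lt0_exponential_pdf// (le_lt_trans zx).
have neg0 : exponential_prob rate `]-oo, 0[%classic = 0%E.
  rewrite /exponential_prob integral0_eq// => z; rewrite /= in_itv/= => z0.
  by rewrite lt0_exponential_pdf.
have -> : `]-oo, x]%classic = `]-oo, 0[%classic `|` `[0, x]%classic.
  apply/seteqP; split => z /=; rewrite !in_itv/=.
    by move=> ->; rewrite andbT; case: ltP; [left|right].
  by case=> [z0|/andP[]//]; rewrite (le_trans (ltW z0)).
pose E := exponential_law rate_gt0.
transitivity (E `]-oo, 0%R[%classic + E `[0%R, x]%classic)%E.
  apply: measureU => //; apply/seteqP; split=> // z /=; rewrite !in_itv/=.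
  by case=> z0 /andP[]; rewrite leNgt z0.
rewrite [X in (X + _)%E]neg0 add0e.
move: x0; rewrite le_eqVlt => /predU1P[<-|x0].
  by rewrite mulr0 expR0 subrr set_itv1 /E /= /exponential_prob integral_set1.
exact: exponential_prob_itv0c.
Qed.

Lemma exponential_dominates : exponential_law rate_gt0 `<< leb.
Proof.
apply/null_content_dominatesP => A mA A0; apply: null_set_integral => //.
apply/measurable_EFinP/measurable_funTS; exact: measurable_exponential_pdf.
Qed.

(** The Radon-Nikodym derivative of the exponential law is its density, up to a
    negligible set. *)
Lemma ge0_integral_exponential (f : measurableTypeR R -> \bar R) :
  measurable_fun setT f -> (forall x, 0 <= f x)%E ->
  (\int[exponential_law rate_gt0]_x f x =
   \int[leb]_x (f x * (exponential_pdf rate x)%:E))%E.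
Proof.
move=> mf f0; have dom := exponential_dominates.
have mpdf : measurable_fun setT (EFin \o exponential_pdf rate).
  by apply/measurable_EFinP; exact: measurable_exponential_pdf.
have mRN := measurable_int _ (Radon_Nikodym_SigmaFinite.f_integrable dom).
rewrite -(Radon_Nikodym_SigmaFinite.change_of_variables dom)//.
apply: ae_eq_integral => //.
- exact: emeasurable_funM.
- exact: emeasurable_funM.
apply: ae_eqe_mul2l; apply: integral_ae_eq => //.
- exact: Radon_Nikodym_SigmaFinite.f_integrable.
- by move=> A _ mA; rewrite -Radon_Nikodym_SigmaFinite.f_integral.
Qed.

End OneRate.

Section TwoRates.
Context {a b : R} (a_gt0 : 0 < a) (b_gt0 : 0 < b) (ab : a != b).

(** [f z] is the density at [x] of the first term times the probability that the
    second one is at most [z - x]; [F z] is an antiderivative of [f z]. *)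
Let F (z x : R) : R :=
  - expR (- a * x) - a / (b - a) * expR (- b * z) * expR ((b - a) * x).
Let f (z x : R) : R := a * expR (- a * x) * (1 - expR (- b * (z - x))).

Let derive_F (z x : R) : is_derive x 1 (F z) (f z x).
Proof.
apply: is_derive_eq; rewrite /f /GRing.scale /= !mulr1.
have split_exp : expR (- a * x) * expR (- b * (z - x)) =
    expR (- b * z) * expR ((b - a) * x).
  by rewrite -!expRD; congr expR; ring.
rewrite [RHS]mulrBr mulr1 -mulrA -[in RHS]mulrA split_exp.
by field; rewrite subr_eq0 eq_sym.
Qed.

Let continuous_F z : continuous (F z).
Proof.
by move=> x; apply/differentiable_continuous/derivable1_diffP; exact: ex_derive.
Qed.

Let continuous_f z : continuous (f z).
Proof.
by move=> x; apply/differentiable_continuous/derivable1_diffP; exact: ex_derive.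
Qed.

(** Both terms are nonnegative, so conditioning on the first one leaves an
    integral over [[0, z]] only. *)
Lemma sum_exponential_cdf z :
  (exponential_law a_gt0 \x exponential_law b_gt0)%E
    (step_into id `]-oo, z]%classic) =
  (1 - (b * expR (- a * Num.max 0 z) - a * expR (- b * Num.max 0 z)) /
    (b - a))%:E.
Proof.
have ba : b - a != 0 by rewrite subr_eq0 eq_sym.
pose g (x : measurableTypeR R) : R := 1 - expR (- b * Num.max 0 (z - x)).
transitivity (\int[exponential_law a_gt0]_x (g x)%:E)%E.
  apply: eq_integral => x _; rewrite -(exponential_cdf b_gt0) /= xsectionE.
  congr (exponential_prob b _); apply/seteqP; split=> v /=;
    by rewrite !in_itv/= lerBrDl.
have mg : measurable_fun setT g.
  apply: measurable_funB => //; apply: measurableT_comp => //.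
  apply: measurable_funM => //; apply: measurable_maxr => //.
  exact: measurable_funB.
rewrite ge0_integral_exponential; last 2 first.
- exact/measurable_EFinP.
- move=> x; rewrite lee_fin subr_ge0 -[leRHS]expR0 ler_expR.
  by rewrite mulNr oppr_le0 mulr_ge0 ?(ltW b_gt0)// le_max lexx.
have [z0|z0] := leP z 0.
  rewrite integral0_eq => [|x _].
    by rewrite !mulr0 expR0 !mulr1 divff// subrr.
  have [x0|x0] := ltP x 0; first by rewrite lt0_exponential_pdf// mule0.
  by rewrite /g max_l ?mulr0 ?expR0 ?subrr ?mul0e// subr_le0 (le_trans z0).
transitivity (\int[leb]_(x in `[0%R, z]) (f z x)%:E)%E.
  rewrite [RHS]integral_mkcond; apply: eq_integral => x _.
  rewrite patchE mem_setE in_itv/=.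
  have [x0|x0] := leP 0 x; last by rewrite lt0_exponential_pdf// mule0.
  rewrite exponential_pdfE// -EFinM /g; have [zx|zx] /= := leP x z.
    by rewrite max_r ?subr_ge0// mulrC.
  by rewrite max_l ?subr_le0 ?ltW// mulr0 expR0 subrr mul0r.
rewrite (@continuous_FTC2 _ _ (F z))//.
- rewrite /F -EFinB; congr _%:E; rewrite !mulr0 !expR0.
  have -> : expR ((b - a) * z) = expR (- a * z) / expR (- b * z).
    by rewrite -expRN -expRD; congr expR; ring.
  by field; rewrite ba gt_eqF// expR_gt0.
- exact: continuous_subspaceT.
- split.
  + by move=> x _; exact: ex_derive.
  + by apply: cvg_at_right_filter; exact: continuous_F.
  + by apply: cvg_at_left_filter; exact: continuous_F.
- by move=> x _; rewrite derive1E; case: (derive_F z x).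
Qed.

End TwoRates.

End Exponential.

(** * The stationary law *)

Section ParetoLaw.
Context {R : realType} (p q theta x0 : R).
Hypotheses (p_gt0 : 0 < p) (q_gt0 : 0 < q) (pq1 : p + q = 1).
Hypothesis (theta_gt0 : 0 < theta).
Local Notation law := (probability (measurableTypeR R) R).
Local Notation mu := (exponential_law theta_gt0).

Let alpha_gt0 : 0 < p * theta := mulr_gt0 p_gt0 theta_gt0.
Local Notation expo := (exponential_law alpha_gt0).

(** The exponential law of rate [p * theta] is that of a geometric number of
    shocks: with probability [p] a single shock, otherwise one more shock on top
    of an independent copy. The two sides have the same cumulative distribution
    function, because [theta - p * theta = q * theta] cancels the weight [q]. *)
Lemma exponential_one_more_shock (B : set R) : measurable B ->
  (expo B = p%:E * mu B + q%:E * (expo \x mu) (step_into id B))%E.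
Proof.
have mD : measurable_fun setT
    (fun uv : measurableTypeR R * measurableTypeR R => id uv.1 + uv.2).
  exact: (measurable_funD measurable_fst measurable_snd).
have [S SE] := image_law (expo \x mu)%E mD.
have [Q QE] := mixture_law mu S (ltW p_gt0) (ltW q_gt0) pq1.
move=> mB; rewrite -[X in (_ * mu _ + _ * X)%E]SE -QE//.
apply: eq_law_cdf mB => z.
have pt : p * theta != theta.
  rewrite -subr_eq0 -[X in _ - X]mul1r -mulrBl mulf_neq0 ?(gt_eqF theta_gt0)//.
  by rewrite lt_eqF// subr_lt0 -pq1 ltrDl.
rewrite QE// SE.
rewrite [LHS]exponential_cdf// [X in (_ = _ * X + _)%E]exponential_cdf//.
rewrite [X in (_ = _ + _ * X)%E]sum_exponential_cdf//.
rewrite -!EFinM -EFinD; congr _%:E.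
have -> : p = 1 - q by rewrite -pq1 addrK.
have q0 : q != 0 by rewrite gt_eqF.
have t0 : theta != 0 by rewrite gt_eqF.
field; have -> : theta - (1 - q) * theta = q * theta by ring.
by rewrite mulf_neq0.
Qed.

Let shift (u : measurableTypeR R) : measurableTypeR R := x0 + u.

Let measurable_shift : measurable_fun setT shift.
Proof. exact: measurable_funD. Qed.

Let measurable_shift_preimage (B : set R) :
  measurable B -> measurable (shift @^-1` B).
Proof.
by move=> mB; rewrite -[X in measurable X]setTI; exact: measurable_shift.
Qed.

Lemma shifted_product (Q : law) (B : set R) : measurable B ->
  (forall A : set R, Q A = expo (shift @^-1` A)) ->
  (Q \x mu)%E (step_into id B) =
  (expo \x mu)%E (step_into id (shift @^-1` B)).
Proof.
move=> mB QE; pose f (uv : measurableTypeR R * measurableTypeR R) :=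
  (shift uv.1, uv.2).
have mf : measurable_fun setT f.
  apply: measurable_fun_pair => //.
  exact: (measurableT_comp measurable_shift measurable_fst).
have mC : measurable (step_into id B) by exact: measurable_step_into.
have QmuE A1 A2 : measurable A1 -> measurable A2 ->
    (expo \x mu)%E (f @^-1` (A1 `*` A2)) = (Q A1 * mu A2)%E.
  move=> mA1 mA2; transitivity (expo (shift @^-1` A1) * mu A2)%E.
    by apply: product_measure1E => //; exact: measurable_shift_preimage.
  by congr (_ * _)%E; exact/esym/QE.
have fB : f @^-1` step_into id B = step_into id (shift @^-1` B).
  by apply/seteqP; split => -[u v]; rewrite /step_into /f /shift /= addrA.
apply: etrans (esym (image_product_measure mf QmuE mC)) _.
exact: (congr1 (expo \x mu)%E fB).
Qed.

(** A reset contributes the atom at [x0]. An income shock from that atom and one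
    from the exponential part add up to the shifted exponential law, by
    [exponential_one_more_shock]. *)
Lemma pareto_step_invariant (phi : law) (B : set R) :
  (forall A : set R, measurable A ->
    phi A = p%:E * \d_x0 A + q%:E * expo (shift @^-1` A))%E ->
  measurable B ->
  (q%:E * (phi \x mu) (step_into id B) +
   p%:E * (phi \x \d_(0%R : measurableTypeR R)) (step_into (cst x0) B) =
   phi B)%E.
Proof.
move=> phiE mB; have [S SE] := image_law expo measurable_shift.
have mC : measurable (step_into id B) by exact: measurable_step_into.
rewrite (mixture_product (a := p) (b := q) (P1 := \d_(x0 : measurableTypeR R))
  (P2 := S) _ (ltW p_gt0) (ltW q_gt0) _ mC); last first.
  by move=> A mA; rewrite SE phiE.
rewrite (shifted_product mB SE).
have -> : (\d_(x0 : measurableTypeR R) \x mu)%E (step_into id B) =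
    mu (shift @^-1` B).
  rewrite [LHS]integral_dirac//; last exact: measurable_fun_xsection.
  by rewrite diracT mul1e /= xsectionE.
have -> : (phi \x \d_(0%R : measurableTypeR R))%E (step_into (cst x0) B) =
    \d_x0 B.
  transitivity (\int[phi]_x \d_x0 B)%E.
    apply: eq_integral => x _; rewrite /= xsectionE !diracE; congr (_%:R%:E).
    by congr nat_of_bool; apply/idP/idP; rewrite !inE /step_into /= addr0.
  rewrite integral_cst// -[RHS]mule1 -(probability_setT phi).
  by [].
rewrite -exponential_one_more_shock ?phiE// 1?addeC//.
exact: measurable_shift_preimage.
Qed.

Lemma pareto_tail (phi : law) x :
  (forall A : set R, measurable A ->
    phi A = p%:E * \d_x0 A + q%:E * expo (shift @^-1` A))%E ->
  x0 < x -> phi `]x, +oo[%classic = (q * expR (- (p * theta) * (x - x0)))%:E.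
Proof.
move=> phiE x0x; rewrite phiE// diracE.
have -> : (x0 \in `]x, +oo[%classic) = false.
  apply/negbTE; rewrite notin_setE /= in_itv/= andbT => /(lt_trans x0x).
  by rewrite ltxx.
rewrite mule0 add0e EFinM; congr (_ * _)%E.
have -> : shift @^-1` `]x, +oo[%classic = ~` `]-oo, x - x0]%classic.
  apply/seteqP; split=> u; rewrite setCitvl /= !in_itv/= !andbT ltrBlDl//.
rewrite probability_setC// [X in (_ - X)%E]exponential_cdf//.
by rewrite max_r ?subr_ge0 ?ltW// -EFinB subKr.
Qed.

Lemma pareto_law_exists : exists phi : law, forall A : set R, measurable A ->
  (phi A = p%:E * \d_x0 A + q%:E * expo (shift @^-1` A))%E.
Proof.
have [S SE] := image_law expo measurable_shift.
have [phi phiE] := mixture_law (\d_(x0 : measurableTypeR R)) S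
  (ltW p_gt0) (ltW q_gt0) pq1.
by exists phi => A mA; rewrite phiE// SE.
Qed.

End ParetoLaw.

Theorem corollary7p1 (d : measure_display) (T : measurableType d)
    (R : realType) (P : probability T R)
    (lambda1 lambda2 theta x0 : R)
    (lambda1_gt0 : 0 < lambda1) (lambda2_gt0 : 0 < lambda2)
    (theta_gt0 : 0 < theta)
    (L : log_income_process P lambda1 lambda2
           (exponential_prob theta) (dirac (0 : R)) (cst x0)) :
  let q := lambda1 / (lambda1 + lambda2) in
  let alpha := lambda2 * theta / (lambda1 + lambda2) in
  let y0 := expR x0 in
  exists phi : probability (measurableTypeR R) R,
    [/\ stationary_distribution L phi,
        (forall psi : probability (measurableTypeR R) R,
           stationary_distribution L psi ->
           forall B : set R, measurable B -> psi B = phi B) &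
        forall (d' : measure_display) (T' : measurableType d')
          (P' : probability T' R) (X : {RV P' >-> R}),
          (forall B : set R, measurable B -> distribution P' X B = phi B) ->
          forall y : R, y0 < y ->
            P' [set w | y < expR (X w)] =
            (q * (y / y0) `^ (- alpha))%:E].
Proof.
move=> q alpha y0.
have lambda_gt0 : 0 < lambda1 + lambda2 by exact: addr_gt0.
pose p := lambda2 / (lambda1 + lambda2).
have p_gt0 : 0 < p by rewrite divr_gt0.
have q_gt0 : 0 < q by rewrite divr_gt0.
have pq1 : p + q = 1 by rewrite -mulrDl addrC divff// gt_eqF.
have alphaE : alpha = p * theta by rewrite /alpha /p mulrAC.
pose L' : log_income_process P lambda1 lambda2 (exponential_law theta_gt0)
  (\d_(0 : measurableTypeR R)) (cst x0) := L.
have [phi phiE] := pareto_law_exists x0 p_gt0 q_gt0 pq1 theta_gt0.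
have phi_stationary : stationary_distribution L phi.
  apply: (@invariant_stationary _ _ _ _ _ _ _ _ _ L') => B mB.
  exact: pareto_step_invariant phiE mB.
exists phi; split=> // [psi psi_stationary B mB|d' T' P' X XE y y0y].
  have unique := @stationary_unique _ _ _ _ _ _ _ _ _ L'.
  exact: unique psi_stationary phi_stationary B mB.
have y_gt0 : 0 < y by apply: lt_trans y0y; exact: expR_gt0.
have -> : [set w | y < expR (X w)] = X @^-1` `]ln y, +oo[%classic.
  by apply/seteqP; split=> w /=; rewrite in_itv/= andbT -(ltr_expR (ln y)) lnK.
rewrite -[LHS]/(distribution P' X `]ln y, +oo[%classic) XE//.
have x0_lt : x0 < ln y by rewrite -ltr_expR lnK.
rewrite (pareto_tail phiE x0_lt) /powR gt_eqF ?divr_gt0 ?expR_gt0//.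
by rewrite ln_div ?posrE ?expR_gt0// expRK alphaE.
Qed.
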